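(* Let $L>0$, $\lambda>6$, and let $v$ be a solution of the problem $$v_t+D^4v+D^2v=\tfrac12D(v^2),\qquad v(x,0)=v_0(x),\qquad B_0(v)=h(t)\ \text{ at } x=0 \text{ for } t>0,$$ such that $H_\lambda(v,L):=B_0(v)-C_\lambda(L)\ge0$ for all $t>0$ for which the solution exists, and $$J_0:=\int_0^L v_0(x)|x-L|^\lambda\,dx>0.$$ Then $v$ cannot be global in time: there is no global solution of this problem. Moreover, there is no global solution of this problem for $x\in(0,L)$, and, as long as the solution exists, $$J(t):=\int_0^L v(x,t)|x-L|^\lambda\,dx\ \ge\ \frac{J_0}{1-J_0\kappa^2t},\qquad \kappa=\Big(\frac{\lambda(\lambda+2)}4L^{-(2+\lambda)}\Big)^{1/2},$$ so that the blow-up time satisfies $T_\infty<\dfrac1{\kappa^2J_0}$.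
   Context: Here $D=\partial/\partial x$, $\Omega=(0,L)$, and for $\lambda>6$, $L>0$: $$B_0(v)=-\tfrac12L^\lambda v^2(0,t)+\lambda L^{\lambda-1}\big[1+(\lambda-1)(\lambda-2)L^{-2}\big]v(0,t)+L^\lambda\big[1+\lambda(\lambda-1)L^{-2}\big]Dv(0,t)+\lambda L^{\lambda-1}D^2v(0,t)+L^\lambda D^3v(0,t),$$ $$C_\lambda(L)=\lambda(\lambda-1)^2L^{\lambda-6}\Big[\frac{(\lambda-2)^2(\lambda-3)^2}{\lambda-6}+\frac{2(\lambda-2)(\lambda-3)}{\lambda-4}L^2+\frac1{\lambda-2}L^4\Big].$$ A solution is understood in the weak sense: $v$ belongs to a function class in which the following makes sense, and for every $\psi\in C^4(\mathbb R)$, $$\frac{d}{dt}\int_\Omega v\psi\,dx+\int_\Omega v(D^4\psi+D^2\psi)\,dx=-\frac12\int_\Omega v^2D\psi\,dx+B(v,\psi),$$ $$B(v,\psi)=\Big[vD^3\psi-Dv\,D^2\psi+(D^2v+v)D\psi-(D^3v+Dv)\psi+\tfrac12v^2\psi\Big]_{x=0}^{x=L},$$ with initial data attained in the sense $\int_\Omega v(x,t)\psi(x)\,dx\to\int_\Omega v_0\psi\,dx$ as $t\to0$. The blow-up time $T_\infty$ is the supremum of times up to which the solution exists. *)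

(* Defs.v *)
From HB Require Import structures.
From mathcomp Require Export all_boot all_order all_algebra.
From mathcomp Require Export all_classical all_reals all_analysis.
Export Order.TTheory GRing.Theory Num.Theory.
Export numFieldNormedType.Exports.

Set Implicit Arguments.
Unset Strict Implicit.
Unset Printing Implicit Defensive.

#[global] Open Scope classical_set_scope.
#[global] Open Scope ring_scope.

(* In ring_scope, [f^`(n)] is the formal derivative of a polynomial; the
   analytic n-th derivative is [derive1n n f]. *)
Local Notation D := derive1n.

Section KuramotoSivashinsky.
Context {R : realType}.
Implicit Types (f psi h : R -> R) (v : R -> R -> R) (F : set_system R)
  (L lambda t x : R) (T : \bar R) (n k : nat).

Definition is_Cn n psi : Prop :=
  (forall k x, (k < n)%N -> derivable (D k psi) x 1) /\ continuous (D n psi).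

Definition integral_Omega L f : R :=
  \int[lebesgue_measure]_(x in `]0, L[) f x.

(* A function of space and time is written [v t x], so that [v t] is the
   spatial profile at time [t]. *)

(* The boundary value of [D^k f] at an end point is the one-sided limit from
   inside Omega: [F] is [0^'+] or [L^'-]. *)
Definition trace F f k : R := lim (D k f x @[x --> F]).

Definition has_traces F f : Prop :=
  (forall k, (k < 3)%N -> \forall x \near F, derivable (D k f) x 1) /\
  (forall k, (k <= 3)%N -> cvg (D k f x @[x --> F])).

(* A minimal class in which every term of the weak identity makes sense:
   [f] is in L^2(Omega) and [f, ..., D^3 f] have traces at both end points.
   In particular C^3 up to the boundary, hence H^4(Omega), is included. *)
Definition admissible L f : Prop :=
  [/\ measurable_fun `]0, L[ f,
      (@lebesgue_measure R).-integrable `]0, L[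
        (fun x => (f x ^+ 2)%:E),
      has_traces 0^'+ f & has_traces L^'- f].

Definition boundary_form F f psi x : R :=
  let d := trace F f in
  d 0%N * D 3 psi x - d 1%N * D 2 psi x
  + (d 2%N + d 0%N) * D 1 psi x - (d 3%N + d 1%N) * psi x
  + 2^-1 * d 0%N ^+ 2 * psi x.

Definition B L f psi : R :=
  boundary_form L^'- f psi L - boundary_form 0^'+ f psi 0.

Definition B0 L lambda f : R :=
  let d := trace 0^'+ f in
  - (2^-1 * L `^ lambda * d 0%N ^+ 2)
  + lambda * L `^ (lambda - 1)
    * (1 + (lambda - 1) * (lambda - 2) * L ^- 2) * d 0%N
  + L `^ lambda * (1 + lambda * (lambda - 1) * L ^- 2) * d 1%N
  + lambda * L `^ (lambda - 1) * d 2%N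
  + L `^ lambda * d 3%N.

Definition C_ L lambda : R :=
  lambda * (lambda - 1) ^+ 2 * L `^ (lambda - 6)
  * ((lambda - 2) ^+ 2 * (lambda - 3) ^+ 2 / (lambda - 6)
     + 2 * (lambda - 2) * (lambda - 3) / (lambda - 4) * L ^+ 2
     + (lambda - 2)^-1 * L ^+ 4).

Definition H L lambda f : R := B0 L lambda f - C_ L lambda.

Definition weak_identity L v t : Prop :=
  forall psi, is_Cn 4 psi ->
    is_derive t 1 (fun s => integral_Omega L (fun x => v s x * psi x))
      (- integral_Omega L (fun x => v t x * (D 4 psi x + D 2 psi x))
       - 2^-1 * integral_Omega L (fun x => v t x ^+ 2 * D 1 psi x)
       + B L (v t) psi).

Definition attains_initial_data L (v0 : R -> R) v : Prop :=
  (@lebesgue_measure R).-integrable `]0, L[ (fun x => (v0 x)%:E) /\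
  forall psi, is_Cn 4 psi ->
    integral_Omega L (fun x => v t x * psi x) @[t --> 0^'+] -->
    integral_Omega L (fun x => v0 x * psi x).

(* [v] is a weak solution for 0 < t < T; [T = +oo] is a global solution.
   Nothing is required of [v] outside Omega, so solutions posed on a larger
   spatial domain are covered. *)
Definition is_solution L lambda (v0 : R -> R) h T v : Prop :=
  attains_initial_data L v0 v /\
  forall t, 0 < t -> (t%:E < T)%E ->
    [/\ admissible L (v t), weak_identity L v t & B0 L lambda (v t) = h t].

Definition existence_times L lambda (v0 : R -> R) h v : set (\bar R) :=
  [set T | (0 < T)%E /\ is_solution L lambda v0 h T v].

Definition blowup_time L lambda (v0 : R -> R) h v : \bar R :=
  ereal_sup (existence_times L lambda v0 h v).

Definition J L lambda f : R :=
  integral_Omega L (fun x => f x * `|x - L| `^ lambda).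

Definition kappa L lambda : R :=
  Num.sqrt (lambda * (lambda + 2) / 4 * L `^ (- (2 + lambda))).

End KuramotoSivashinsky.

(* Main.v *)
Require Import Defs.
From mathcomp Require Import measurable_realfun ring lra.

(** Testing the equation with the weight [psi x = (L - x) `^ lambda], extended
    by [0] to the right of [L], turns it into a Riccati inequality for the
    weighted mean [J].

    Because [lambda > 6], the weight is of class [C^4] and vanishes with its
    first three derivatives at [L]; the boundary form then reduces to its
    contribution at [0], which is exactly [B0] ([B_weight]). The weak identity
    reads, with [w = (L - x) `^ (lambda - 1)] and [G = D 4 psi + D 2 psi],
      [J' = lambda / 2 * (integral of v^2 w) - (integral of v G) + B0].
    Young's inequality spends one half of the quadratic term on the linear one:
      [v G <= lambda / 4 * v^2 w + G^2 / (lambda w)],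
    and the integral of the last term is precisely [C_], so that [H >= 0]
    compensates it. By Cauchy-Schwarz the other half is at least
    [kappa^2 J^2], because [psi = (L - x) w] and the integral of
    [(L - x)^2 w] is [L `^ (lambda + 2) / (lambda + 2)] ([J_sqr_le]).

    Hence [J' > kappa^2 J^2]. The inequality is strict because equality in
    Young's inequality would require [v] to behave like [(L - x)^-3] near [L],
    while [v] has a finite trace there ([integral_defect_gt0]). As [J] tends to
    its positive initial value [J0] at time [0], it stays positive, and
    [1 / J + kappa^2 t] decreases strictly from [1 / J0] ([riccati_comparison]). This gives the lower bound
    on [J], and, since [1 / J] remains positive, a strict upper bound on the
    life span ([riccati_blowup]). *)

Set Implicit Arguments.
Unset Strict Implicit.
Unset Printing Implicit Defensive.

Local Notation D := derive1n.

(** * Truncated powers *)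

Lemma powRDn (R : realType) (y p : R) (k : nat) : 0 < y ->
  y `^ (p + k%:R) = y `^ p * y ^+ k.
Proof.
by move=> y0; rewrite powRD ?(gt_eqF y0) ?implybT// powR_mulrn// ltW.
Qed.

Section TruncatedPower.
Context {R : realType}.
Implicit Types (L p x : R).
Local Notation mu := (@lebesgue_measure R).

(** The maximum, rather than [L - x] alone, matters because the real power of a
    negative base is [1]: with it, the family is continuous and closed under
    differentiation across the point [L]. *)
Definition trpow L p x : R := Num.max (L - x) 0 `^ p.

Lemma trpow_in L p x : x < L -> trpow L p x = (L - x) `^ p.
Proof. by move=> xL; rewrite /trpow max_l// subr_ge0 ltW. Qed.

Lemma trpow_out L p x : p != 0 -> L <= x -> trpow L p x = 0.
Proof. by move=> p0 Lx; rewrite /trpow max_r ?subr_le0// powR0. Qed.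

Lemma trpow_ge0 L p x : 0 <= trpow L p x.
Proof. exact: powR_ge0. Qed.

Lemma is_derive_trpow_in L p x : x < L ->
  is_derive x 1 (trpow L p) (- p * trpow L (p - 1) x).
Proof.
move=> xL; rewrite trpow_in//.
have Lx : 0 < L - x by rewrite subr_gt0.
have d : is_derive x 1 ((@powR R ^~ p) \o (fun z => L - z)) (- p * (L - x) `^ (p - 1)).
  rewrite mulNr -mulrN1; apply: is_derive1_comp; first exact: is_derive1_powR.
  by rewrite -[-1]sub0r; apply: is_deriveB.
apply: near_eq_is_derive d.
near=> z; rewrite /= trpow_in//.
by near: z; exact: lt_nbhsl.
Unshelve. all: by end_near. Qed.

Lemma continuous_trpow_in L p x : x < L -> {for x, continuous (trpow L p)}.
Proof.
move=> xL; apply: differentiable_continuous; apply/derivable1_diffP.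
by case: (is_derive_trpow_in p xL).
Qed.

(** At points [x >= L], where the value is [0], smallness of [L - z] is turned
    into smallness of the power by raising it to [p^-1]. *)
Lemma continuous_trpow L p : 0 < p -> continuous (trpow L p).
Proof.
move=> p0 x; have [xL|Lx] := ltP x L; first exact: continuous_trpow_in.
rewrite /continuous_at trpow_out ?gt_eqF//.
apply/cvgrPdist_lt => e e0; near=> z; rewrite sub0r normrN ger0_norm ?trpow_ge0//.
rewrite -[e](@powRr1 _ e) ?ltW// -(@mulVf _ p) ?gt_eqF// powRrM.
rewrite /trpow gt0_ltr_powR ?nnegrE ?powR_ge0 ?le_max ?lexx ?orbT//.
rewrite gt_max powR_gt0// andbT.
have : L - e `^ p^-1 < z.
  near: z; apply: lt_nbhsr.
  by rewrite (lt_le_trans _ Lx)// ltrBlDr ltrDl powR_gt0.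
by rewrite ltrBlDr ltrBlDl addrC.
Unshelve. all: by end_near. Qed.

(** Only the junction [x = L] is delicate: there the difference quotient with
    increment [h] is bounded in absolute value by [trpow L (p - 1) (h + x)],
    which tends to [0] because [p - 1 > 0]. *)
Lemma is_derive_trpow L p x : 1 < p ->
  is_derive x 1 (trpow L p) (- p * trpow L (p - 1) x).
Proof.
move=> p1; have [xL|Lx] := ltP x L; first exact: is_derive_trpow_in.
have p0 : p != 0 by rewrite gt_eqF// (lt_trans ltr01).
have p10 : 0 < p - 1 by rewrite subr_gt0.
rewrite trpow_out ?gt_eqF// mulr0.
suff c : h^-1 *: (trpow L p (h *: 1 + x) - trpow L p x) @[h --> 0^'] --> (0:R).
  by apply: DeriveDef; [apply/cvg_ex; exists 0|exact: cvg_lim].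
apply/cvgrPdist_le => e e0.
have /cvgrPdist_le/(_ _ e0)/nbhs0P := @continuous_trpow L _ p10 x.
rewrite trpow_out ?gt_eqF// => cx.
near=> h; rewrite sub0r normrN.
apply: (@le_trans _ _ (trpow L (p - 1) (h + x))); last first.
  rewrite -[leLHS]ger0_norm ?trpow_ge0// -normrN -sub0r [h + x]addrC.
  near: h; apply: nbhs_dnbhs; exact: cx.
rewrite (@trpow_out L p x)// subr0 [h *: 1]mulr1 normrM.
have hneq0 : h != 0 by near: h; exact: nbhs_dnbhs_neq.
have [hxL|Lhx] := ltP (h + x) L; last first.
  by rewrite (@trpow_out L p)// normr0 mulr0 trpow_ge0.
rewrite !trpow_in//; set y := L - (h + x).
have y0 : 0 < y by rewrite subr_gt0.
have yh : y <= `|h|.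
  have h0 : h < 0 by rewrite -(ltrD2r x) add0r (lt_le_trans hxL).
  by rewrite ltr0_norm// /y; lra.
rewrite normfV [`|_ `^ _|]ger0_norm ?powR_ge0//.
rewrite ler_pdivrMl ?normr_gt0//.
rewrite -(@mulr_powRB1 _ y p) ?(ltW y0)// ?(lt_trans ltr01)//.
by rewrite ler_wpM2r// powR_ge0.
Unshelve. all: by end_near. Qed.

Lemma derive1n_trpow L p n : n%:R < p ->
  derive1n n (trpow L p) = fun x => \prod_(i < n) (i%:R - p) * trpow L (p - n%:R) x.
Proof.
elim: n => [|n ih] np.
  by apply/funext => x; rewrite derive1n0 big_ord0 mul1r subr0.
have np' : n%:R < p by rewrite (lt_trans _ np)// ltr_nat.
have p1 : 1 < p - n%:R by rewrite ltrBrDr nat1r.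
apply/funext => x; rewrite derive1nS ih// derive1E.
have d := @is_derive_trpow L _ x p1.
have dZ := @is_deriveZ _ _ _ _ (\prod_(i < n) (i%:R - p)) x 1 _ d.
have -> := @derive_val _ _ _ _ _ _ _ dZ.
rewrite big_ord_recr/= /GRing.scale/= mulrA opprB.
by rewrite -natr1 opprD addrA.
Qed.

Lemma is_Cn_trpow L p n : n%:R < p -> is_Cn n (trpow L p).
Proof.
move=> np; split => [k x kn|].
  have kp : k%:R < p by rewrite (lt_trans _ np)// ltr_nat.
  rewrite derive1n_trpow//; apply: derivableZ.
  apply: (@ex_derive _ _ _ _ _ _ _ (@is_derive_trpow L _ x _)).
  rewrite ltrBrDr (le_lt_trans _ np)// nat1r ler_nat//.
rewrite derive1n_trpow// => x; apply: cvgM; first exact: cvg_cst.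
by apply: continuous_trpow; rewrite subr_gt0.
Qed.

Lemma measurable_trpow L p (D : set R) : measurable_fun D (trpow L p).
Proof.
apply: measurable_funTS; apply: (@measurableT_comp _ _ _ _ _ _ (@powR R ^~ p)).
  exact: measurable_powR.
by apply: measurable_maxr => //; apply: measurable_funB.
Qed.

Lemma integral_trpow_itv L p b : -1 < p -> 0 < b < L ->
  (\int[mu]_(x in `[0%R, b]) (trpow L p x)%:E =
   ((p + 1)^-1 * (L `^ (p + 1) - trpow L (p + 1) b))%:E)%E.
Proof.
move=> p1 /andP[b0 bL].
have p10 : 0 < p + 1 by rewrite -(opprK 1) subr_gt0.
pose F := fun x => - (p + 1)^-1 * trpow L (p + 1) x.
have cF : continuous F.
  by move=> x; apply: cvgM; [exact: cvg_cst|exact: continuous_trpow].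
have dF x : x < L -> is_derive x 1 F (trpow L p x).
  move=> xL; have d := @is_deriveZ _ _ _ _ (- (p + 1)^-1) x 1 _ (is_derive_trpow_in (p + 1) xL).
  by apply: is_derive_eq d _; rewrite addrK /GRing.scale/= mulrA mulrNN mulVf ?mul1r ?gt_eqF.
rewrite (@continuous_FTC2 _ _ F)//.
- rewrite -EFinB /F; congr EFin.
  by rewrite [trpow L _ 0]trpow_in ?(lt_trans b0)// subr0; ring.
- apply: continuous_in_subspaceT => x; rewrite inE/= in_itv/= => /andP[_ xb].
  by apply: continuous_trpow_in; rewrite (le_lt_trans xb).
- split.
  + move=> x; rewrite in_itv/= => /andP[_ xb].
    by case: (dF x (lt_trans xb bL)).
  + exact/cvg_at_right_filter/cF.
  + exact/cvg_at_left_filter/cF.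
- move=> x; rewrite in_itv/= => /andP[_ xb].
  have d := dF x (lt_trans xb bL).
  by rewrite derive1E; exact: derive_val.
Qed.

(** For [-1 < p < 0] the integrand blows up at [L], so the fundamental theorem
    of calculus is applied on [[0, b]] and [b] is sent to [L] by monotone
    convergence. *)
Lemma integral_trpow L p : 0 < L -> -1 < p ->
  (\int[mu]_(x in `]0%R, L[) (trpow L p x)%:E = (L `^ (p + 1) / (p + 1))%:E)%E.
Proof.
move=> L0 p1.
have p10 : 0 < p + 1 by rewrite -(opprK 1) subr_gt0.
rewrite -(@integral_itv_bndoo _ _ _ _ true true); last first.
  apply/measurable_EFinP.
  exact: measurable_trpow.
pose b n : R := L - L * n.+2%:R^-1.
have b0 n : 0 < b n.
  by rewrite subr_gt0 -[ltRHS]mulr1 ltr_pM2l// invf_lt1// ltr1n.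
have bL n : b n < L by rewrite ltrBlDr ltrDl mulr_gt0.
have -> : `[0, L[%classic = \bigcup_n `[0, b n]%classic.
  apply/seteqP; split => x /=.
  - rewrite in_itv/= => /andP[x0 xL].
    have Lx : 0 < L - x by rewrite subr_gt0.
    pose n := Num.truncn (L / (L - x)).
    (* [n] is such that [L / n.+2 <= L - x]. *)
    exists n => //=; rewrite in_itv/= x0/= /b lerBrDr -lerBrDl.
    rewrite ler_pdivrMr// mulrC -ler_pdivrMr//.
    have /andP[_ /ltW h] := truncn_itv (divr_ge0 (ltW L0) (ltW Lx)).
    by rewrite (le_trans h)// ler_nat.
  - move=> [n _]; rewrite /= !in_itv/= => /andP[-> xb]; exact: (le_lt_trans xb).
have h : (\int[mu]_(x in `[0%R, b i]) (trpow L p x)%:E @[i --> \oo] -->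
     \int[mu]_(x in \bigcup_i `[0%R, b i]%classic) (trpow L p x)%:E)%E.
  apply: ge0_nondecreasing_set_cvg_integral => //=.
  - move=> m n mn; rewrite subsetEset; apply: subset_itvl; rewrite bnd_simp/=.
    rewrite lerB// ler_pM2l// lef_pV2 ?posrE// ler_nat//.
  - by move=> i; apply/measurable_EFinP; exact: measurable_trpow.
  - by move=> i x _; rewrite lee_fin trpow_ge0.
apply/esym/(cvg_unique _ _ h) => //.
rewrite /=; under eq_fun do rewrite integral_trpow_itv ?b0 ?bL//.
apply/cvg_EFin; first by near=> i.
rewrite [X in _ --> X](_ : _ = (p + 1)^-1 * (L `^ (p + 1) - trpow L (p + 1) L)); last first.
  by rewrite trpow_out ?gt_eqF// subr0 mulrC.
apply: cvgM; first exact: cvg_cst.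
apply: cvgB; first exact: cvg_cst.
apply: continuous_cvg => //; first exact: continuous_trpow.
rewrite -[X in _ --> X]subr0 -[X in _ - X](mulr0 L).
apply: cvgB; first exact: cvg_cst.
apply: cvgM; first exact: cvg_cst.
by have := @cvg_harmonic R; rewrite -cvg_shiftS; exact: cvg_trans.
Unshelve. all: by end_near. Qed.

Lemma integrable_trpow L p : 0 < L -> -1 < p ->
  mu.-integrable `]0, L[ (fun x => (trpow L p x)%:E).
Proof.
move=> L0 p1; apply/integrableP; split.
  by apply/measurable_EFinP; exact: measurable_trpow.
under eq_integral do rewrite gee0_abs ?lee_fin ?trpow_ge0//.
by rewrite integral_trpow// ltry.
Qed.

Lemma Rintegral_trpow L p : 0 < L -> -1 < p ->
  integral_Omega L (trpow L p) = L `^ (p + 1) / (p + 1).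
Proof. by move=> L0 p1; rewrite /integral_Omega /Rintegral integral_trpow. Qed.

End TruncatedPower.

(** * Riccati differential inequality *)

Section Riccati.
Context {R : realType}.
Implicit Types (s t : R).

(** Strictness survives the passage to the limit by comparing with the value at
    the intermediate time [t / 2]. *)
Lemma at_right_limit_lt (g : R -> R) (l : R) (T : \bar R) :
  (forall s t, 0 < s -> s < t -> (t%:E < T)%E -> g t < g s) ->
  g s @[s --> 0^'+] --> l ->
  forall t, 0 < t -> (t%:E < T)%E -> g t < l.
Proof.
move=> decr gl t t0 tT; have t20 : 0 < t / 2 by rewrite divr_gt0.
have t2t : t / 2 < t by rewrite ltr_pdivrMr// ltr_pMr// ltr1n.
apply: (lt_le_trans (decr _ _ t20 t2t tT)).
have <- : lim (g s @[s --> 0^'+]) = l by exact: cvg_lim.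
apply: limr_ge; first by apply/cvg_ex; exists l.
near=> s; apply/ltW/decr; first by near: s; exact: nbhs_right_gt.
  by near: s; exact: nbhs_right_lt.
by apply: lt_trans tT; rewrite lte_fin.
Unshelve. all: by end_near. Qed.

Lemma derive_gt0_incr (g dg : R -> R) (T : \bar R) :
  (forall t, 0 < t -> (t%:E < T)%E -> is_derive t 1 g (dg t) /\ 0 < dg t) ->
  forall s t, 0 < s -> s < t -> (t%:E < T)%E -> g s < g t.
Proof.
move=> dgP s t s0 st tT.
have inT x : x \in `[s, t] -> 0 < x /\ (x%:E < T)%E.
  rewrite in_itv/= => /andP[sx xt]; split; first exact: lt_le_trans sx.
  by rewrite (le_lt_trans _ tT)// lee_fin.
have inT' x : x \in `]s, t[ -> 0 < x /\ (x%:E < T)%E.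
  by move=> /subset_itv_oo_cc; exact: inT.
apply: (@gtr0_derive1_lt_cc _ g s t) => //.
- by move=> x /inT'[x0 xT]; case: (dgP x x0 xT) => -[].
- move=> x /inT'[x0 xT]; case: (dgP x x0 xT) => d ?.
  by rewrite derive1E (@derive_val _ _ _ _ _ _ _ d).
- apply: derivable_within_continuous => x /inT[x0 xT].
  by case: (dgP x x0 xT) => -[].
- by rewrite bound_itvE ltW.
- by rewrite bound_itvE ltW.
Qed.

(** Dividing [f' > k f^2] by [f^2] says that [1 / f + k t] decreases strictly.
    Positivity of [f], which makes the division possible, holds because [f]
    increases from the positive limit [a]. *)
Lemma riccati_comparison (f df : R -> R) (k a : R) (T : \bar R) :
  0 < k -> 0 < a -> f t @[t --> 0^'+] --> a ->
  (forall t, 0 < t -> (t%:E < T)%E ->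
     is_derive t 1 f (df t) /\ k * f t ^+ 2 < df t) ->
  [/\ forall t, 0 < t -> (t%:E < T)%E -> 0 < f t,
      forall s t, 0 < s -> s < t -> (t%:E < T)%E ->
        (f t)^-1 + k * t < (f s)^-1 + k * s
    & forall t, 0 < t -> (t%:E < T)%E -> (f t)^-1 + k * t < a^-1].
Proof.
move=> k0 a0 fa fP.
have incr : forall s t, 0 < s -> s < t -> (t%:E < T)%E -> f s < f t.
  apply: (derive_gt0_incr (dg := df)) => t t0 tT.
  have [d lt] := fP t t0 tT; split => //; apply: le_lt_trans lt.
  by rewrite mulr_ge0 ?sqr_ge0 ?ltW.
have f0 t : 0 < t -> (t%:E < T)%E -> 0 < f t.
  move=> t0 tT; apply: (lt_trans a0); rewrite -ltrN2.
  apply: (@at_right_limit_lt (fun s => - f s) _ T) => //.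
    by move=> s u *; rewrite ltrN2; exact: incr.
  exact: cvgN.
have decr : forall s t, 0 < s -> s < t -> (t%:E < T)%E ->
    (f t)^-1 + k * t < (f s)^-1 + k * s.
  move=> s u s0 su uT; rewrite -ltrN2.
  apply: (@derive_gt0_incr (fun s => - ((f s)^-1 + k * s))
    (fun t => df t / f t ^+ 2 - k) T) => // {s u s0 su uT} t t0 tT.
  have [d lt] := fP t t0 tT; have ft0 := f0 t t0 tT; split; last first.
    by rewrite subr_gt0 ltr_pdivlMr ?exprn_gt0.
  have d1 := is_deriveV (lt0r_neq0 ft0) d.
  have d2 := @is_deriveZ _ _ _ _ k _ _ _ (@is_derive_id _ _ t (1:R)).
  have := is_deriveN (is_deriveD d1 d2).
  move/is_derive_eq; apply.
  by rewrite /GRing.scale/= mulr1 opprD mulNr opprK mulrC.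
split => // t t0 tT.
apply: (at_right_limit_lt (g := fun s => (f s)^-1 + k * s) decr) => //.
rewrite -[X in _ --> X]addr0 -[X in _ + X](mulr0 k).
apply: cvgD; first by apply: cvgV => //; rewrite gt_eqF.
by apply: cvgM; [exact: cvg_cst|exact/cvg_at_right_filter/cvg_id].
Qed.

(** Since [1 / f > 0], the decreasing quantity [g = 1 / f + k t] bounds time by
    [g s / k] for any fixed [s], and [g s < 1 / a] makes the bound on [T]
    strict. *)
Lemma riccati_blowup (f df : R -> R) (k a : R) (T : \bar R) :
  0 < k -> 0 < a -> (0 < T)%E -> f t @[t --> 0^'+] --> a ->
  (forall t, 0 < t -> (t%:E < T)%E ->
     is_derive t 1 f (df t) /\ k * f t ^+ 2 < df t) ->
  (forall t, 0 < t -> (t%:E < T)%E -> a / (1 - a * k * t) <= f t) /\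
  (T < (1 / (k * a))%:E)%E.
Proof.
move=> k0 a0 T0 fa fP; have [f0 decr C] := riccati_comparison k0 a0 fa fP; split.
  move=> t t0 tT; have ft0 := f0 t t0 tT; have h := C t t0 tT.
  have hh : f t * a * ((f t)^-1 + k * t) < f t * a * a^-1 by rewrite ltr_pM2l ?mulr_gt0.
  have e1 : f t * a * ((f t)^-1 + k * t) = a + f t * (a * k * t).
    by field; rewrite gt_eqF.
  have e2 : f t * a * a^-1 = f t by field; rewrite gt_eqF.
  move: hh; rewrite e1 e2 => hh.
  have pos : 0 < 1 - a * k * t.
    by rewrite -(pmulr_rgt0 _ ft0) mulrBr mulr1 subr_gt0 (lt_trans _ hh)// ltrDr.
  by rewrite ler_pdivrMr// mulrBr mulr1; lra.
have [s /andP[s0 sT]] : exists s : R, (0 < s%:E < T)%E.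
  case: T T0 {fP f0 decr C} => [r| |]//.
    rewrite lte_fin => r0; exists (r / 2); rewrite !lte_fin divr_gt0//=.
    by rewrite ltr_pdivrMr// ltr_pMr// ltr1n.
  by move=> _; exists 1; rewrite lte_fin ltr01 ltry.
rewrite lte_fin in s0.
have fs0 := f0 s s0 sT; have hs := C s s0 sT.
apply: (@le_lt_trans _ _ (((f s)^-1 + k * s) / k)%:E); last first.
  by rewrite lte_fin ltr_pdivrMr// (lt_le_trans hs)// mul1r invfM mulrAC mulVf ?mul1r ?gt_eqF.
rewrite leNgt; apply/negP => bT.
pose b := ((f s)^-1 + k * s) / k.
have sb : s < b by rewrite ltr_pdivlMr// mulrC ltrDr invr_gt0.
have fb0 := f0 b (lt_trans s0 sb) bT; have := decr s b s0 sb bT.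
by rewrite /b mulrCA divff ?gt_eqF// mulr1 gtrDr ltNge invr_ge0 ltW.
Qed.

End Riccati.

(** * Integration on the space interval *)

Lemma Rintegral_gt0 d (T : measurableType d) (R : realType)
    (mu : {measure set T -> \bar R}) (A S : set T) (f : T -> R) :
  measurable A -> measurable S -> S `<=` A -> (0 < mu S)%E ->
  mu.-integrable A (EFin \o f) -> (forall x, A x -> 0 <= f x) ->
  (forall x, S x -> 0 < f x) -> 0 < \int[mu]_(x in A) f x.
Proof.
move=> mA mS SA muS fi f0 fS; rewrite lt_neqAle Rintegral_ge0// andbT.
apply/eqP => int0.
have mf : measurable_fun A (EFin \o f) := measurable_int _ fi.
have abs0 : (\int[mu]_(x in A) `|(EFin \o f) x| = 0)%E.
  rewrite -[RHS]/(0%:E) int0 /Rintegral fineK; last exact: integrable_fin_num.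
  by apply: eq_integral => x xA; rewrite gee0_abs// lee_fin f0//; exact: set_mem.
have /(@negligibleS _ _ _ _ _ S) : mu.-negligible (~` [set x | A x -> f x = 0]).
  have [+ _] := @ae_eq_integral_abs _ _ _ mu _ mA _ mf.
  move=> /(_ abs0); apply: negligibleS => x /= h h'; apply: h => Ax.
  by have [] := h' Ax.
move=> -/(_ _) /(measure_negligible mS) h.
by move: muS; rewrite h ?ltxx// => x Sx /= /(_ (SA _ Sx)) fx0; move: (fS x Sx); rewrite fx0 ltxx.
Qed.

Section Energy.
Context {R : realType}.
Local Notation mu := (@lebesgue_measure R).
Variable L : R.
Hypothesis L0 : 0 < L.
Local Notation Omega := `]0, L[%classic.

Definition Omega_integrable (f : R -> R) := mu.-integrable Omega (EFin \o f).
Local Notation integrableO := Omega_integrable.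

Let mO : measurable (Omega : set (measurableTypeR R)). Proof. exact: measurable_itv. Qed.

Lemma integrableOD f g :
  integrableO f -> integrableO g -> integrableO (fun x => f x + g x).
Proof. by move=> fi gi; have := integrableD mO fi gi. Qed.

Lemma integrableOB f g :
  integrableO f -> integrableO g -> integrableO (fun x => f x - g x).
Proof. by move=> fi gi; have := integrableB mO fi gi. Qed.

Lemma integrableOZ c f : integrableO f -> integrableO (fun x => c * f x).
Proof. by move=> fi; have := integrableZl mO c fi. Qed.

Lemma integrableOMpow p f : 0 < p ->
  integrableO f -> integrableO (fun x => f x * trpow L p x).
Proof.
move=> p0 fi.
have mfi := measurable_int _ fi.
apply: (le_integrable mO _ _ (integrableOZ (L `^ p) fi)) => /=.
  apply/measurable_EFinP; apply: measurable_funM.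
    by apply/measurable_EFinP.
  exact: measurable_trpow.
move=> x; rewrite /= in_itv/= => /andP[x0 xL].
rewrite lee_fin !normrM mulrC ler_wpM2r//.
rewrite !ger0_norm ?powR_ge0// trpow_in//.
apply: ge0_ler_powR; rewrite ?nnegrE ?subr_ge0 ?ltW//.
by rewrite ltrBlDr ltrDl.
Qed.

(** [`|f| <= 1 + f^2], and constants are integrable on a bounded interval. *)
Lemma admissible_integrable f : admissible L f -> integrableO f.
Proof.
move=> [mf f2i _ _].
have one : integrableO (fun=> 1).
  apply: measurable_bounded_integrable => //.
    have := lebesgue_measure_itv `]0, L[; rewrite /= lte_fin L0 -EFinB => ->.
    exact: ltry.
  by exists 1; split => // M M1 x _ /=; rewrite normr1 ltW.
apply: (le_integrable mO _ _ (integrableOD one f2i)) => /=.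
  exact/measurable_EFinP.
move=> x _; rewrite lee_fin [leRHS]ger0_norm ?addr_ge0 ?sqr_ge0//.
rewrite -real_normK ?num_real//; have := sqr_ge0 (`|f x| - 1).
have := normr_ge0 (f x); nra.
Qed.

Lemma integralOD f g : integrableO f -> integrableO g ->
  integral_Omega L (fun x => f x + g x) = integral_Omega L f + integral_Omega L g.
Proof. by move=> fi gi; exact: RintegralD. Qed.

Lemma integralOB f g : integrableO f -> integrableO g ->
  integral_Omega L (fun x => f x - g x) = integral_Omega L f - integral_Omega L g.
Proof. by move=> fi gi; exact: RintegralB. Qed.

Lemma integralOZ c f : integrableO f ->
  integral_Omega L (fun x => c * f x) = c * integral_Omega L f.
Proof. by move=> fi; exact: RintegralZl. Qed.

End Energy.

(** * The weight and the energy inequality *)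

Section Weight.
Context {R : realType}.
Variables (L lambda : R).
Hypotheses (L0 : 0 < L) (lambda6 : 6 < lambda).
Local Notation mu := (@lebesgue_measure R).
Local Notation psi := (trpow L lambda).

Let lambda_gt k : (k <= 6)%N -> 0 < lambda - k%:R.
Proof. by move=> k6; rewrite subr_gt0 (le_lt_trans _ lambda6)// ler_nat. Qed.

Let lambda_gt0 : 0 < lambda. Proof. by rewrite (lt_trans _ lambda6). Qed.

Lemma is_C4_weight : is_Cn 4 psi.
Proof. by apply: is_Cn_trpow; rewrite (lt_trans _ lambda6)// ltr_nat. Qed.

Lemma D1_weight x : D 1 psi x = - lambda * trpow L (lambda - 1) x.
Proof.
rewrite derive1n_trpow; last by rewrite (lt_trans _ lambda6)// ltr_nat.
by rewrite big_ord_recr big_ord0/=; ring.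
Qed.

Lemma D2_weight x : D 2 psi x = lambda * (lambda - 1) * trpow L (lambda - 2) x.
Proof.
rewrite derive1n_trpow; last by rewrite (lt_trans _ lambda6)// ltr_nat.
by rewrite !big_ord_recr big_ord0/=; ring.
Qed.

Lemma D3_weight x : D 3 psi x =
  - (lambda * (lambda - 1) * (lambda - 2)) * trpow L (lambda - 3) x.
Proof.
rewrite derive1n_trpow; last by rewrite (lt_trans _ lambda6)// ltr_nat.
by rewrite !big_ord_recr big_ord0/=; ring.
Qed.

Lemma D4_weight x : D 4 psi x =
  lambda * (lambda - 1) * (lambda - 2) * (lambda - 3) * trpow L (lambda - 4) x.
Proof.
rewrite derive1n_trpow; last by rewrite (lt_trans _ lambda6)// ltr_nat.
by rewrite !big_ord_recr big_ord0/=; ring.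
Qed.

(** The weight and its first three derivatives vanish at [L], so only the
    boundary terms at [0] survive; [B0] is what they add up to. *)
Lemma boundary_form_weight_right (F : set_system R) f : boundary_form F f psi L = 0.
Proof.
rewrite /boundary_form D1_weight D2_weight D3_weight.
rewrite !(@trpow_out _ L _ L)//; first by rewrite !mulr0 !(addr0, subr0).
- by rewrite gt_eqF.
- by rewrite gt_eqF//; exact: (@lambda_gt 1).
- by rewrite gt_eqF//; exact: (@lambda_gt 2).
- by rewrite gt_eqF//; exact: (@lambda_gt 3).
Qed.

Lemma B_weight f : B L f psi = B0 L lambda f.
Proof.
rewrite /B boundary_form_weight_right sub0r.
rewrite /boundary_form D1_weight D2_weight D3_weight.
rewrite !(@trpow_in _ L _ 0)// subr0 /B0.
have powD (k : nat) : L `^ (lambda - k%:R) = L `^ lambda / L ^+ k.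
  by rewrite powRB ?(gt_eqF L0) ?implybT// powR_mulrn// ltW.
rewrite (powD 1%N) (powD 2%N) (powD 3%N).
move: (L `^ lambda) (trace _ _ 0) (trace _ _ 1) (trace _ _ 2) (trace _ _ 3).
move=> P d0 d1 d2 d3; have Ln0 : L != 0 by rewrite gt_eqF.
by field.
Qed.

Lemma J_weight f : J L lambda f = integral_Omega L (fun x => f x * psi x).
Proof.
apply: eq_Rintegral => x; rewrite inE/= in_itv/= => /andP[_ xL].
by rewrite trpow_in// distrC ger0_norm// subr_ge0 ltW.
Qed.

Let A : R := (lambda - 2) * (lambda - 3).

(** With [w := trpow L (lambda - 1)] and [G := D 4 psi + D 2 psi], this is what
    is lost when Young's inequality bounds [f * G] by
    [lambda / 4 * f^2 * w + G^2 / (lambda * w)]. The quotient [G^2 / w] is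
    expanded into powers, whose integrals are the three terms of [C_]. *)
Definition defect (f : R -> R) (x : R) : R :=
  lambda / 4 * (f x ^+ 2 * trpow L (lambda - 1) x)
  - f x * (D 4 psi x + D 2 psi x)
  + lambda * (lambda - 1) ^+ 2 *
    (A ^+ 2 * trpow L (lambda - 7) x + 2 * A * trpow L (lambda - 5) x
     + trpow L (lambda - 3) x).

(** All powers are multiples of [(L - x) `^ (lambda - 7)] by integer powers of
    [L - x], which exhibits the perfect square. *)
Lemma defect_square f x : x < L ->
  defect f x = lambda * (L - x) `^ (lambda - 7) *
    (f x * (L - x) ^+ 3 / 2 - (lambda - 1) * (A + (L - x) ^+ 2)) ^+ 2.
Proof.
move=> xL; rewrite /defect D4_weight D2_weight !trpow_in//.
set y := L - x; have y0 : 0 < y by rewrite subr_gt0.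
have -> : lambda - 1 = lambda - 7 + 6%:R by ring.
have -> : lambda - 2 = lambda - 7 + 5%:R by ring.
have -> : lambda - 4 = lambda - 7 + 3%:R by ring.
have -> : lambda - 5 = lambda - 7 + 2%:R by ring.
have e3 : lambda - 3 = lambda - 7 + 4%:R by ring.
by rewrite e3 !(powRDn _ _ y0) /A; field.
Qed.

Lemma integrable_weight_term f : Omega_integrable L f ->
  Omega_integrable L (fun x => f x * (D 4 psi x + D 2 psi x)).
Proof.
move=> fi.
have -> : (fun x => f x * (D 4 psi x + D 2 psi x)) =
  fun x => lambda * (lambda - 1) * A * (f x * trpow L (lambda - 4) x) +
           lambda * (lambda - 1) * (f x * trpow L (lambda - 2) x).
  by apply/funext => x; rewrite D4_weight D2_weight /A; ring.
apply: integrableOD; apply: integrableOZ; apply: integrableOMpow => //.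
  exact: (@lambda_gt 4).
exact: (@lambda_gt 2).
Qed.

Let integrable_young_remainder : Omega_integrable L (fun x =>
  A ^+ 2 * trpow L (lambda - 7) x + 2 * A * trpow L (lambda - 5) x
     + trpow L (lambda - 3) x).
Proof.
have l6 := lambda6; have l7 : -1 < lambda - 7 by lra.
have l5 : -1 < lambda - 5 by lra.
have l3 : -1 < lambda - 3 by lra.
apply: integrableOD; last exact: integrable_trpow.
by apply: integrableOD; apply: integrableOZ; exact: integrable_trpow.
Qed.

(** The hypothesis [6 < lambda] makes the most singular power integrable. *)
Lemma integral_young_remainder :
  lambda * (lambda - 1) ^+ 2 * integral_Omega L (fun x =>
  A ^+ 2 * trpow L (lambda - 7) x + 2 * A * trpow L (lambda - 5) x
     + trpow L (lambda - 3) x) = C_ L lambda.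
Proof.
have l6 := lambda6; have l7 : -1 < lambda - 7 by lra.
have l5 : -1 < lambda - 5 by lra.
have l3 : -1 < lambda - 3 by lra.
have i7 : Omega_integrable L (trpow L (lambda - 7)) by exact: integrable_trpow.
have i5 : Omega_integrable L (trpow L (lambda - 5)) by exact: integrable_trpow.
have i3 : Omega_integrable L (trpow L (lambda - 3)) by exact: integrable_trpow.
rewrite integralOD//; last by apply: integrableOD; exact: integrableOZ.
rewrite integralOD; [|exact: integrableOZ..].
rewrite !integralOZ// !Rintegral_trpow// /C_.
have -> : lambda - 7 + 1 = lambda - 6 by ring.
have -> : lambda - 5 + 1 = lambda - 6 + 2%:R by ring.
have -> : lambda - 3 + 1 = lambda - 6 + 4%:R by ring.
rewrite !powRDn// /A.
have h6 := lambda_gt (leqnn 6).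
have h4 := @lambda_gt 4 isT.
have h2 := @lambda_gt 2 isT.
by field; rewrite !gt_eqF//; lra.
Qed.

Lemma integral_defect f : admissible L f ->
  Omega_integrable L (defect f) /\
  integral_Omega L (defect f) =
    lambda / 4 * integral_Omega L (fun x => f x ^+ 2 * trpow L (lambda - 1) x)
    - integral_Omega L (fun x => f x * (D 4 psi x + D 2 psi x)) + C_ L lambda.
Proof.
move=> af; have fi := admissible_integrable L0 af.
have f2i : Omega_integrable L (fun x => f x ^+ 2) by case: af.
have i2 : Omega_integrable L (fun x => f x ^+ 2 * trpow L (lambda - 1) x).
  by apply: integrableOMpow => //; exact: (@lambda_gt 1).
have i1 := integrable_weight_term fi.
have i3 := integrableOZ (lambda * (lambda - 1) ^+ 2) integrable_young_remainder.
have i4 := integrableOZ (lambda / 4) i2.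
have i5 := integrableOB i4 i1.
split; first exact: integrableOD i3.
rewrite -integral_young_remainder /defect integralOD// integralOB//.
by rewrite !integralOZ//; exact: integrable_young_remainder.
Qed.

Lemma defect_ge0 f x : x < L -> 0 <= defect f x.
Proof.
by move=> xL; rewrite defect_square// mulr_ge0 ?sqr_ge0// mulr_ge0 ?powR_ge0// ltW.
Qed.

(** Equality in Young's inequality would force [f] to grow like [(L - x)^-3],
    which a trace at [L] forbids: inside the square, the term with [f] tends
    to [0] and the other one to [- (lambda - 1) * A]. *)
Lemma defect_gt0_near f : cvg (f x @[x --> L^'-]) ->
  \forall x \near L^'-, 0 < defect f x.
Proof.
move=> /cvg_ex[l fl].
have A0 : 0 < (lambda - 1) * A.
  by rewrite /A !mulr_gt0//; [exact: (@lambda_gt 1)|exact: (@lambda_gt 2)|exact: (@lambda_gt 3)].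
have : (f x * (L - x) ^+ 3 / 2 - (lambda - 1) * (A + (L - x) ^+ 2)) @[x --> L^'-] --> - ((lambda - 1) * A).
  have y0 : (L - x) @[x --> L^'-] --> (0:R).
    rewrite -[X in _ --> X](subrr L); apply: cvgB; first exact: cvg_cst.
    exact/cvg_at_left_filter/cvg_id.
  have -> : - ((lambda - 1) * A) = l * (0 * 0 * 0) / 2 - (lambda - 1) * (A + 0 * 0) by ring.
  under eq_fun do rewrite exprSr !expr2.
  apply: cvgB.
    apply: cvgM; last exact: cvg_cst.
    by apply: cvgM => //; do 2 (apply: cvgM => //).
  apply: cvgM; first exact: cvg_cst.
  by apply: cvgD; [exact: cvg_cst|exact: cvgM].
move/cvgr_lt => /(_ 0); rewrite oppr_lt0 => /(_ A0) neg.
near=> x.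
have xL : x < L by near: x; exact: nbhs_left_lt.
rewrite defect_square// mulr_gt0//.
  by rewrite mulr_gt0// powR_gt0// subr_gt0.
rewrite exprn_even_gt0//= lt_eqF//.
by near: x.
Unshelve. all: by end_near. Qed.

Lemma integral_defect_gt0 f : admissible L f -> 0 < integral_Omega L (defect f).
Proof.
move=> af; have [di _] := integral_defect af.
have cf : cvg (f x @[x --> L^'-]) by case: af => _ _ _ [_] /(_ 0%N isT).
have [e /= e0 He] := defect_gt0_near cf.
pose a := Num.max 0 (L - e).
have aL : a < L by rewrite gt_max L0 ltrBlDr ltrDl.
apply: (@Rintegral_gt0 _ _ _ mu `]0, L[%classic `]a, L[%classic) => //.
- by apply: subset_itvr; rewrite bnd_simp le_max lexx.
- have := lebesgue_measure_itv `]a, L[; rewrite /= lte_fin aL -EFinB => ->.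
  by rewrite lte_fin subr_gt0.
- by move=> x; rewrite /= in_itv/= => /andP[_]; exact: defect_ge0.
- move=> x; rewrite /= in_itv/= gt_max => /andP[/andP[_ ex] xL].
  apply: He => //=; rewrite ger0_norm ?subr_ge0 ?ltW//.
  by rewrite ltrBlDr addrC -ltrBlDr.
Qed.

Lemma kappa_sqr : kappa L lambda ^+ 2 = lambda / 4 * ((lambda + 2) / L `^ (lambda + 2)).
Proof.
rewrite /kappa sqr_sqrtr; last first.
  by rewrite mulr_ge0 ?powR_ge0// divr_ge0// mulr_ge0 ?addr_ge0 ?ltW.
by rewrite powRN [2 + lambda]addrC; field; rewrite gt_eqF ?powR_gt0.
Qed.

(** Cauchy-Schwarz for [psi = (L - x) * w] in the measure of density
    [w = (L - x) `^ (lambda - 1)], obtained by integrating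
    [w * (f - c * (L - x))^2 >= 0]. *)
Lemma J_sqr_le f : admissible L f ->
  kappa L lambda ^+ 2 * J L lambda f ^+ 2 <=
  lambda / 4 * integral_Omega L (fun x => f x ^+ 2 * trpow L (lambda - 1) x).
Proof.
move=> af; have fi := admissible_integrable L0 af.
have f2i : Omega_integrable L (fun x => f x ^+ 2) by case: af.
rewrite kappa_sqr -mulrA ler_pM2l ?divr_gt0//.
set m := (lambda + 2) / _.
have m0 : 0 < m by rewrite divr_gt0 ?powR_gt0 ?addr_gt0.
(* [m^-1] is the integral of [(L - x)^2 * w]; this [c] is optimal. *)
pose c := J L lambda f * m.
have i2 : Omega_integrable L (fun x => f x ^+ 2 * trpow L (lambda - 1) x).
  by apply: integrableOMpow => //; exact: (@lambda_gt 1).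
have i1 : Omega_integrable L (fun x => f x * trpow L lambda x).
  exact: integrableOMpow.
have l6 := lambda6; have p1 : -1 < lambda + 1 by lra.
have i0 : Omega_integrable L (trpow L (lambda + 1)) by exact: integrable_trpow.
have : 0 <= integral_Omega L (fun x => f x ^+ 2 * trpow L (lambda - 1) x
   - 2 * c * (f x * trpow L lambda x) + c ^+ 2 * trpow L (lambda + 1) x).
  apply: Rintegral_ge0 => x; rewrite /= in_itv/= => /andP[_ xL].
  rewrite !trpow_in//; set y := L - x; have y0 : 0 < y by rewrite subr_gt0.
  have -> : y `^ (lambda + 1) = y `^ (lambda - 1) * y ^+ 2.
    by rewrite -powRDn//; congr (_ `^ _); ring.
  have -> : y `^ lambda = y `^ (lambda - 1) * y ^+ 1.
    by rewrite -powRDn//; congr (_ `^ _); ring.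
  rewrite (_ : _ + _ = y `^ (lambda - 1) * (f x - c * y) ^+ 2); last by ring.
  by rewrite mulr_ge0 ?powR_ge0 ?sqr_ge0.
rewrite integralOD//; [|by apply: integrableOB => //; exact: integrableOZ|exact: integrableOZ].
rewrite integralOB//; last exact: integrableOZ.
rewrite !integralOZ// -J_weight Rintegral_trpow//.
have -> : L `^ (lambda + 1 + 1) / (lambda + 1 + 1) = m^-1.
  by rewrite /m invf_div -addrA.
rewrite (_ : _ + _ = integral_Omega L (fun x => f x ^+ 2 * trpow L (lambda - 1) x)
    - m * J L lambda f ^+ 2) ?subr_ge0//.
by rewrite /c; field; rewrite gt_eqF.
Qed.

(** Half of the quadratic term [lambda / 2 * f^2 * w] absorbs the linear term,
    at the price of [C_], and the other half dominates the square of [J]. *)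
Lemma energy_inequality f : admissible L f ->
  kappa L lambda ^+ 2 * J L lambda f ^+ 2 <
  - integral_Omega L (fun x => f x * (D 4 psi x + D 2 psi x))
  - 2^-1 * integral_Omega L (fun x => f x ^+ 2 * D 1 psi x) + C_ L lambda.
Proof.
move=> af.
have f2i : Omega_integrable L (fun x => f x ^+ 2) by case: af.
have [_ id] := integral_defect af.
have := integral_defect_gt0 af; rewrite id.
have := J_sqr_le af.
have -> : integral_Omega L (fun x => f x ^+ 2 * D 1 psi x) =
   - lambda * integral_Omega L (fun x => f x ^+ 2 * trpow L (lambda - 1) x).
  rewrite -integralOZ//; last by apply: integrableOMpow => //; exact: (@lambda_gt 1).
  by congr integral_Omega; apply/funext => x; rewrite D1_weight//; ring.
lra.
Qed.

End Weight.

(** * Blow-up *)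

Section Blowup.
Context {R : realType}.
Variables (L lambda : R) (v0 h : R -> R).
Hypotheses (L0 : 0 < L) (lambda6 : 6 < lambda).

Lemma blowup_time_solution v t : (t%:E < blowup_time L lambda v0 h v)%E ->
  exists2 T, is_solution L lambda v0 h T v & (t%:E < T)%E.
Proof. by move=> /ereal_sup_gt[T [_ sol] tT]; exists T. Qed.

Lemma kappa_sqr_gt0 : 0 < kappa L lambda ^+ 2.
Proof.
have l6 := lambda6.
by rewrite kappa_sqr// mulr_gt0// divr_gt0 ?powR_gt0//; lra.
Qed.

Lemma J_initial v T : is_solution L lambda v0 h T v ->
  J L lambda (v t) @[t --> 0^'+] --> J L lambda v0.
Proof.
move=> [[_ init] _]; rewrite J_weight//.
under eq_fun do rewrite J_weight//.
exact/init/is_C4_weight.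
Qed.

(** The hypothesis on [H] says that the boundary term [B0] pays for the
    constant [C_] lost in [energy_inequality]. *)
Lemma J_riccati v T t : is_solution L lambda v0 h T v ->
  0 < t -> (t%:E < T)%E -> 0 <= H L lambda (v t) ->
  let Jv s := J L lambda (v s) in
  is_derive t 1 Jv (derive1 Jv t) /\
  kappa L lambda ^+ 2 * Jv t ^+ 2 < derive1 Jv t.
Proof.
move=> [_ sol] t0 tT Ht Jv; have [adm weak _] := sol t t0 tT.
have := weak _ (is_C4_weight L lambda6); rewrite (B_weight L0 lambda6).
have <- : Jv = fun s => integral_Omega L (fun x => v s x * trpow L lambda x).
  by apply/funext => s; exact: J_weight.
move=> d; rewrite derive1E (@derive_val _ _ _ _ _ _ _ d).
split=> //; apply: lt_le_trans (energy_inequality L0 lambda6 adm) _.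
by rewrite lerD2l -subr_ge0.
Qed.

Lemma weighted_mean_blowup v : existence_times L lambda v0 h v !=set0 ->
  0 < J L lambda v0 ->
  (forall t, 0 < t -> (t%:E < blowup_time L lambda v0 h v)%E ->
     0 <= H L lambda (v t)) ->
  (forall t, 0 < t -> (t%:E < blowup_time L lambda v0 h v)%E ->
     J L lambda v0 / (1 - J L lambda v0 * kappa L lambda ^+ 2 * t)
     <= J L lambda (v t)) /\
  (blowup_time L lambda v0 h v
     < (1 / (kappa L lambda ^+ 2 * J L lambda v0))%:E)%E.
Proof.
move=> [T0 exT0] J0 Hv; have [T00 sol0] := exT0.
pose Jv t := J L lambda (v t).
apply: (@riccati_blowup _ Jv (derive1 Jv) _ _ (blowup_time L lambda v0 h v)).
- exact: kappa_sqr_gt0.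
- exact: J0.
- by apply: (lt_le_trans T00); apply: ereal_sup_ubound.
- exact: J_initial sol0.
move=> t t0 tT; have [T sol tT'] := blowup_time_solution tT.
by apply: (J_riccati sol) => //; exact: Hv.
Qed.

End Blowup.

Theorem theorem3p2 (R : realType) (L lambda : R) (v0 h : R -> R) :
  0 < L -> 6 < lambda -> 0 < J L lambda v0 ->
  (~ exists w : R -> R -> R,
       is_solution L lambda v0 h +oo%E w /\
       forall t : R, 0 < t -> 0 <= H L lambda (w t)) /\
  (forall v : R -> R -> R,
     existence_times L lambda v0 h v !=set0 ->
     (forall t : R, 0 < t -> (t%:E < blowup_time L lambda v0 h v)%E ->
        0 <= H L lambda (v t)) ->
     [/\ ~ is_solution L lambda v0 h +oo%E v,
         (forall t : R, 0 < t -> (t%:E < blowup_time L lambda v0 h v)%E ->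
            J L lambda v0 / (1 - J L lambda v0 * kappa L lambda ^+ 2 * t)
            <= J L lambda (v t))
       & (blowup_time L lambda v0 h v
          < (1 / (kappa L lambda ^+ 2 * J L lambda v0))%:E)%E]).
Proof.
move=> L0 lambda6 J0.
have noglobal v : existence_times L lambda v0 h v !=set0 ->
    (forall t : R, 0 < t -> (t%:E < blowup_time L lambda v0 h v)%E ->
        0 <= H L lambda (v t)) -> ~ is_solution L lambda v0 h +oo%E v.
  move=> ex Hv sol; have [_] := weighted_mean_blowup L0 lambda6 ex J0 Hv.
  apply/negP; rewrite -leNgt; apply: (le_trans (leey _)).
  by apply: ereal_sup_ubound; split; first exact: ltry.
split.
  move=> [w [sol Hw]]; apply: (noglobal w) => //.
    by exists +oo%E; split; first exact: ltry.
  by move=> t t0 _; exact: Hw.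
move=> v ex Hv; have [est time] := weighted_mean_blowup L0 lambda6 ex J0 Hv.
by split; [exact: noglobal|exact: est|exact: time].
Qed.
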